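(* Let $G$ be a 5-dimensional Riemannian Lie group with Lie algebra $\mathfrak g$, carrying a left-invariant, minimal and conformal distribution $\mathcal V$ generated by the Riemannian subalgebra $\mathfrak g_4$, i.e. $\mathcal V=\mathrm{span}\{X,Y,Z\}$ where $\{X,Y,Z,A,B\}$ is an adapted orthonormal basis of $\mathfrak g$ (see context) and $$[Z,X]=X,\quad [Z,Y]=X+Y,\quad [X,Y]=0.$$ Then the Lie algebra $\mathfrak g$ is one of the following five; in each of them $[Z,X]=X$, $[Z,Y]=X+Y$, and the remaining bracket relations are as listed. (1) $[Z,A]=a_3A+b_3B+x_5X+y_5Y$, $\ [Z,B]=-b_3A+a_3B+x_6X+y_6Y$. (2) $2[Z,A]=A+2b_3B+2x_5X+2y_5Y$, $\ 2[Z,B]=-2b_3A+B+2x_6X+2y_6Y$, $\ [A,B]=\theta_1X$. (3) $[Y,B]=x_4X$, $\ [Z,A]=x_5X+y_5Y$, $\ [Z,B]=x_6X+y_6Y$, $\ [A,B]=rA-(rx_5-ry_5-x_4y_5)X-ry_5Y$. (4) $[Y,A]=x_3X$, $\ [Y,B]=x_4X$, $\ [Z,A]=x_5X+y_5Y$, $\ [Z,B]=x_6X+y_6Y$, $\ [A,B]=(x_4y_5-x_3y_6)X$. (5) $[X,B]=y_4X$, $\ [Y,B]=y_4X+y_4Y$, $\ [Z,A]=-2A+x_5X+y_5Y$, $\ [Z,B]=-2B+x_6X+y_6Y-2y_4Z$, $\ [A,B]=-2y_4A+x_5y_4X+y_4y_5Y$.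
   Context: A Riemannian Lie group is a Lie group $G$ equipped with a left-invariant Riemannian metric $g=\langle\cdot,\cdot\rangle$; this is an inner product on its Lie algebra $\mathfrak g$. A left-invariant distribution $\mathcal V$ is identified with a subspace of $\mathfrak g$; it is integrable iff this subspace is a subalgebra $\mathfrak k$. $\mathcal H=\mathcal V^\perp$ is the orthogonal complement; $\mathcal V,\mathcal H$ also denote the orthogonal projections; $\nabla$ is the Levi-Civita connection. Set $B^{\mathcal V}(U,V)=\frac12\mathcal H(\nabla_UV+\nabla_VU)$ for $U,V\in\mathcal V$ and $B^{\mathcal H}(E,F)=\frac12\mathcal V(\nabla_EF+\nabla_FE)$ for $E,F\in\mathcal H$. The integrable distribution $\mathcal V$ is conformal if there is a vector field $V\in\mathcal V$ with $B^{\mathcal H}=g\otimes V$; minimal if $\mathrm{trace}\,B^{\mathcal V}=0$. Adapted orthonormal basis: $\mathcal V$ is a 3-dimensional integrable, conformal, minimal left-invariant distribution on the 5-dimensional $G$, $\{X,Y,Z,A,B\}$ is an orthonormal basis of $\mathfrak g$ with $\mathcal V=\mathrm{span}\{X,Y,Z\}$ and $\mathcal H=\mathrm{span}\{A,B\}$, and $A,B$ are chosen (as is always possible) such that the $\mathcal H$-component of $[A,B]$ is a multiple of $A$. The brackets are then of the form \begin{align*} [X,A]&=a_1A+b_1B+x_1X+y_1Y+z_1Z, & [X,B]&=-b_1A+a_1B+x_2X+y_2Y+z_2Z,\\ [Y,A]&=a_2A+b_2B+x_3X+y_3Y+z_3Z, & [Y,B]&=-b_2A+a_2B+x_4X+y_4Y+z_4Z,\\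 [Z,A]&=a_3A+b_3B+x_5X+y_5Y-(x_1+y_3)Z, & [Z,B]&=-b_3A+a_3B+x_6X+y_6Y-(x_2+y_4)Z,\\ [A,B]&=rA+\theta_1X+\theta_2Y+\theta_3Z, \end{align*} with real constants. In the list in the claim, the letters denote these real structure constants, and brackets of basis elements that are not listed (and not determined by antisymmetry) vanish. *)

(* Defs.v *)
From mathcomp Require Import all_boot all_order all_algebra.
From mathcomp Require Import sesquilinear reals.

Set Implicit Arguments.
Unset Strict Implicit.
Unset Printing Implicit Defensive.

Local Open Scope ring_scope.

(* A Lie group with a left-invariant metric is encoded by its Lie algebra [L],
   the bracket [br] and the inner product [g]; a left-invariant vector field is
   an element of [L], a left-invariant distribution a subspace of [L]. *)

Section RiemannianLieAlgebra.

Variables (R : realType) (L : vectType R).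
Variables (br nabla : {bilinear L -> L -> L}) (g : {dot L for idfun}).

Definition lie_bracket : Prop :=
  (forall x, br x x = 0) /\
  (forall x y z, br x (br y z) + br y (br z x) + br z (br x y) = 0).

(* [nabla u v] is the covariant derivative of [v] along [u].  Inner products of
   left-invariant fields are constant functions, so the compatibility with the
   metric has no derivative term on the left. *)
Definition levi_civita : Prop :=
  (forall u v, nabla u v - nabla v u = br u v) /\
  (forall u v w, 0 = g (nabla u v) w + g v (nabla u w)).

Variable V : {vspace L}.

Definition integrable_dist : Prop :=
  forall u v, u \in V -> v \in V -> br u v \in V.

Definition vert_proj : 'End(L) := daddv_pi V (orthov g V).
Definition hor_proj : 'End(L) := daddv_pi (orthov g V) V.

Definition second_form_vert (u v : L) : L :=
  2%:R^-1 *: hor_proj (nabla u v + nabla v u).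
Definition second_form_hor (e f : L) : L :=
  2%:R^-1 *: vert_proj (nabla e f + nabla f e).

Definition conformal_dist : Prop :=
  exists2 v0, v0 \in V &
    forall e f, e \in orthov g V -> f \in orthov g V ->
      second_form_hor e f = g e f *: v0.

(* The sum is the trace with respect to [g]; it does not depend on the
   orthonormal basis. *)
Definition minimal_dist : Prop :=
  forall s : seq L, basis_of V s -> orthonormal g s ->
    \sum_(u <- s) second_form_vert u u = 0.

Definition adapted_basis (X Y Z A B : L) : Prop :=
  [/\ basis_of fullv [:: X; Y; Z; A; B],
      orthonormal g [:: X; Y; Z; A; B],
      V = <<[:: X; Y; Z]>>%VS,
      orthov g V = <<[:: A; B]>>%VS
    & hor_proj (br A B) \in <[A]>%VS].

End RiemannianLieAlgebra.

Section Families.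

Variables (R : realType) (L : vectType R) (br : {bilinear L -> L -> L}).

Definition g4_brackets (X Y Z : L) : Prop :=
  [/\ br Z X = X, br Z Y = X + Y & br X Y = 0].

Variables X Y Z A B : L.

Definition family1 : Prop :=
  exists a3 b3 x5 y5 x6 y6 : R,
    g4_brackets X Y Z /\
    [/\ br X A = 0,
        br Y A = 0
      & br Z A = a3 *: A + b3 *: B + x5 *: X + y5 *: Y] /\
    [/\ br X B = 0,
        br Y B = 0
      & br Z B = (- b3) *: A + a3 *: B + x6 *: X + y6 *: Y] /\
    br A B = 0.

Definition family2 : Prop :=
  exists b3 x5 y5 x6 y6 th1 : R,
    g4_brackets X Y Z /\
    [/\ br X A = 0,
        br Y A = 0
      & 2 *: br Z A = A + (2 * b3) *: B + (2 * x5) *: X + (2 * y5) *: Y] /\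
    [/\ br X B = 0,
        br Y B = 0
      & 2 *: br Z B = (- (2 * b3)) *: A + B + (2 * x6) *: X + (2 * y6) *: Y] /\
    br A B = th1 *: X.

Definition family3 : Prop :=
  exists x4 x5 y5 x6 y6 r : R,
    g4_brackets X Y Z /\
    [/\ br X A = 0,
        br Y A = 0
      & br Z A = x5 *: X + y5 *: Y] /\
    [/\ br X B = 0,
        br Y B = x4 *: X
      & br Z B = x6 *: X + y6 *: Y] /\
    br A B = r *: A - (r * x5 - r * y5 - x4 * y5) *: X - (r * y5) *: Y.

Definition family4 : Prop :=
  exists x3 x4 x5 y5 x6 y6 : R,
    g4_brackets X Y Z /\
    [/\ br X A = 0,
        br Y A = x3 *: X
      & br Z A = x5 *: X + y5 *: Y] /\
    [/\ br X B = 0,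
        br Y B = x4 *: X
      & br Z B = x6 *: X + y6 *: Y] /\
    br A B = (x4 * y5 - x3 * y6) *: X.

Definition family5 : Prop :=
  exists y4 x5 y5 x6 y6 : R,
    g4_brackets X Y Z /\
    [/\ br X A = 0,
        br Y A = 0
      & br Z A = (- 2) *: A + x5 *: X + y5 *: Y] /\
    [/\ br X B = y4 *: X,
        br Y B = y4 *: X + y4 *: Y
      & br Z B = (- 2) *: B + x6 *: X + y6 *: Y - (2 * y4) *: Z] /\
    br A B = (- (2 * y4)) *: A + (x5 * y4) *: X + (y4 * y5) *: Y.

End Families.

(* Main.v *)
Require Import Defs.
From mathcomp Require Import all_boot all_order all_algebra.
From mathcomp Require Import sesquilinear reals.
From mathcomp Require Import ring lra.
Import Order.TTheory GRing.Theory Num.Theory.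

(** The metric conditions say how brackets with H = <A, B> look.  Koszul's
    identity gives, for all e, f and u,
      g (nabla e f + nabla f e) u = g [u, e] f + g [u, f] e
    ([dot_sym_nabla]).  Hence conformality means that each u in V acts on H,
    modulo V, by a scalar plus an infinitesimal rotation, and minimality means
    that e in H acts on V, modulo H, without trace.

    What remains is the Jacobi identity.  Identify H with the complex line so
    that multiplication by i is A -> B -> -A.

    - Modulo V, the algebra V acts on H by complex scalars.  These commute, so
      the derived algebra <X, Y> of V acts trivially; only Z has a scalar
      c = a + i b.
    - Jacobi on (X, Y, E) shows that each E in H preserves <X, Y>.  Let M_E be
      u |-> [u, E] on <X, Y>, let T = ad Z on <X, Y> and n = T - 1, which is
      nilpotent.  The trace condition makes - tr M_E the coefficient of Z in
      [Z, E], and Jacobi on (Z, u, E) becomes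
          M_(cE) = [n, M_E] - (tr M_E) T.
      Taking traces, tr M_(cE) = - 2 tr M_E, so tr M = 0 unless c = - 2.  If
      tr M = 0, then M_A - i M_B is an eigenvector, for the value c, of the
      nilpotent operator ad n, so M = 0 unless c = 0; for c = 0 the M_E are
      traceless and commute with n, hence are multiples of n.  If c = - 2 the
      equation forces M_E = (tr M_E / 2) T
      ([vertical_action_cases]).
    - In all cases the M_E commute, so Jacobi on (X, A, B) and (Y, A, B) reads
      r M_A = t3 T, where r and t3 are the coefficients of A and Z in [A, B].
      Together with Jacobi on (Z, A, B), a nonzero c gives families 1 and 2,
      c = 0 gives families 3 and 4, and M_E a multiple of T gives family 5. *)

Local Open Scope ring_scope.

(** * Left-invariant metrics and brackets *)

Section Metric.
Set Implicit Arguments.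
Unset Strict Implicit.
Unset Printing Implicit Defensive.
Variables (R : realType) (L : vectType R) (g : {dot L for idfun}).
Implicit Types (u v w : L) (V : {vspace L}).

Lemma dotC u v : g u v = g v u.
Proof. by rewrite hermC /= expr0 mul1r. Qed.

Lemma dot_orthov V u v : u \in orthov g V -> v \in V -> g u v = 0.
Proof. by move/mem_orthovP; apply. Qed.

Lemma capv_orthov V : (V :&: orthov g V = 0)%VS.
Proof.
apply/eqP; rewrite -subv0; apply/subvP => u /memv_capP[uV uW].
rewrite memv0; apply: contraT => /(neq0_dnorm_gt0 (s := g)).
by rewrite (dot_orthov uW uV) ltxx.
Qed.

Section Projections.
Variable V : {vspace L}.
Hypothesis VW : (V + orthov g V = fullv)%VS.

Lemma vert_hor_proj w : vert_proj g V w + hor_proj g V w = w.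
Proof. by rewrite daddv_pi_add ?capv_orthov // VW memvf. Qed.

Lemma dot_vert_proj w u : u \in V -> g (vert_proj g V w) u = g w u.
Proof.
move=> uV; rewrite -{2}(vert_hor_proj w) linearDl /=.
by rewrite [X in _ + X](dot_orthov (memv_pi _ _ _) uV) addr0.
Qed.

Lemma dot_hor_proj w e : e \in orthov g V -> g (hor_proj g V w) e = g w e.
Proof.
move=> eW; rewrite -{2}(vert_hor_proj w) linearDl /=.
by rewrite [X in X + _]dotC [X in X + _](dot_orthov eW (memv_pi _ _ _)) add0r.
Qed.

End Projections.

Lemma orthonormal_coord s v :
  orthonormal g s -> v \in <<s>>%VS -> v = \sum_(e <- s) g v e *: e.
Proof.
elim: s v => [|x s IHs] v; first by rewrite span_nil memv0 big_nil => _ /eqP.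
rewrite /orthonormal /= andbT big_cons span_cons.
case/andP=> /andP[/eqP gxx gs] /andP[/allP oxs os].
case/memv_addP=> _ /vlineP[k ->] [w ws ->].
have g_xs e : e \in s -> g x e = 0 by move/oxs/eqP.
have := IHs w; rewrite /orthonormal gs os => /(_ isT ws) Ew.
have gwx : g w x = 0.
  rewrite Ew linear_sumlz big_seq big1 // => e es.
  by rewrite linearZl_LR /= [g e x]dotC g_xs ?mulr0.
rewrite linearDl linearZl_LR /= gxx gwx mulr1 addr0; congr (_ + _).
rewrite {1}Ew; apply: eq_big_seq => e es.
by rewrite linearDl linearZl_LR /= g_xs // mulr0 add0r.
Qed.

Section LeviCivita.
Variables br nabla : {bilinear L -> L -> L}.
Hypothesis brC : forall u v, br u v = - br v u.
Hypothesis nablaP : levi_civita br nabla g.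

(** Torsion-freeness turns each derivative along e or f into one along u, and
    the derivatives along u cancel by compatibility with the metric. *)
Lemma dot_sym_nabla e f u :
  g (nabla e f + nabla f e) u = g (br u e) f + g (br u f) e.
Proof.
have [tor met] := nablaP.
have t1 := congr1 (g^~ f) (tor e u); have t2 := congr1 (g^~ e) (tor f u).
have m1 := met e f u; have m2 := met f e u; have m3 := met u e f.
rewrite /= (brC e) linearBl linearNl /= in t1.
rewrite /= (brC f) linearBl linearNl /= in t2.
rewrite linearDl /=.
rewrite (dotC f) in m1; rewrite (dotC e) in m2; rewrite (dotC e) in m3.
lra.
Qed.

Variable V : {vspace L}.
Hypothesis VW : (V + orthov g V = fullv)%VS.

(** Pairing with a vertical u removes the projection from the second
    fundamental form of the horizontal distribution, which leaves the bracket
    expression of [dot_sym_nabla]. *)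
Lemma conformal_bracket : conformal_dist nabla g V ->
  exists v0, forall u e f, u \in V -> e \in orthov g V -> f \in orthov g V ->
    g (br u e) f + g (br u f) e = g e f * g v0 u.
Proof.
case=> v0 _ hv; exists (2 *: v0) => u e f uV eW fW.
have := congr1 (g^~ u) (hv e f eW fW).
rewrite /second_form_hor /= !linearZl_LR /= dot_vert_proj // dot_sym_nabla.
lra.
Qed.

(** Minimality concerns V alone, yet it controls the action of horizontal
    vectors: g (nabla u u) e = g [e, u] u. *)
Lemma minimal_bracket s e : minimal_dist nabla g V ->
  basis_of V s -> orthonormal g s -> e \in orthov g V ->
  \sum_(u <- s) g (br u e) u = 0.
Proof.
move=> hmin hs os eW; have := congr1 (g^~ e) (hmin s hs os).
rewrite /= linear0l linear_sumlz => h.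
have E u : g (second_form_vert nabla g V u u) e = - g (br u e) u.
  rewrite /second_form_vert linearZl_LR /= dot_hor_proj // dot_sym_nabla.
  rewrite (brC e) linearNl /=; lra.
move: h; rewrite (eq_bigr _ (fun u _ => E u)) sumrN => /eqP.
by rewrite oppr_eq0 => /eqP.
Qed.

End LeviCivita.
End Metric.

(** * The equation for the action on the derived algebra *)

Section Intertwiner.
Set Implicit Arguments.
Unset Strict Implicit.
Variable R : realType.

(** This is cancellation in the complex numbers: the two equations are the
    parts of (c - i d) (p + i q) = 0, and multiplying by c + i d produces the
    norm. *)
Lemma complex_mul_eq0 (c d p q : R) : (c != 0) || (d != 0) ->
  c * p + d * q = 0 -> c * q - d * p = 0 -> p = 0 /\ q = 0.
Proof.
move=> cd0 e1 e2.
have n0 : c ^+ 2 + d ^+ 2 != 0.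
  by rewrite paddr_eq0 ?sqr_ge0 // !sqrf_eq0 negb_and.
split; apply: (mulfI n0); rewrite mulr0.
  have -> : (c ^+ 2 + d ^+ 2) * p = c * (c * p + d * q) - d * (c * q - d * p).
    by ring.
  by rewrite e1 e2 !mulr0 subr0.
have -> : (c ^+ 2 + d ^+ 2) * q = d * (c * p + d * q) + c * (c * q - d * p).
  by ring.
by rewrite e1 e2 !mulr0 addr0.
Qed.

(** The hypotheses are the entries of M_(cE) = [n, M_E] - (tr M_E) T for E = A
    and E = B, with c = a + i b, where M_A has columns (x1, y1), (x3, y3) and
    M_B has columns (x2, y2), (x4, y4). *)
Lemma intertwiner_cases (a b x1 y1 x2 y2 x3 y3 x4 y4 : R) :
  a * y1 + b * y2 = 0 -> a * y2 - b * y1 = 0 ->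
  a * x1 + b * x2 = y1 - (x1 + y3) -> a * x2 - b * x1 = y2 - (x2 + y4) ->
  a * y3 + b * y4 = - y1 - (x1 + y3) -> a * y4 - b * y3 = - y2 - (x2 + y4) ->
  a * x3 + b * x4 = y3 - x1 - (x1 + y3) ->
  a * x4 - b * x3 = y4 - x2 - (x2 + y4) ->
  [/\ y1 = 0 & y2 = 0] /\
  [\/ [/\ x1 = 0, x2 = 0, x3 = 0, x4 = 0 & (y3 = 0 /\ y4 = 0)] /\
        (a != 0) || (b != 0),
      [/\ a = 0, b = 0, x1 = 0 & x2 = 0] /\ (y3 = 0 /\ y4 = 0)
    | [/\ a = -2, b = 0, y3 = x1 & y4 = x2] /\ (x3 = x1 /\ x4 = x2)].
Proof.
move=> ey ey' ex ex' ez ez' ew ew'.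
have [ab0 | ab0] := boolP ((a != 0) || (b != 0)); last first.
  move: ab0; rewrite negb_or !negbK => /andP[/eqP a0 /eqP b0].
  rewrite a0 b0 in ex ex' ez ez' ew ew' *.
  split; first by split; lra.
  by apply: Or32; do !split=> //; lra.
(* For nonzero c the entries are killed one after another, in the order given by
   the filtration of [ad n]; the trace obeys the same system with c + 2. *)
have [y10 y20] := complex_mul_eq0 ab0 ey ey'.
rewrite y10 y20 in ex ex' ez ez' *; split=> //.
have [cd0 | ] := boolP ((a + 2 != 0) || (b != 0)); last first.
  rewrite negb_or !negbK => /andP[/eqP a2 /eqP b0].
  have {a2}aE : a = -2 by lra.
  rewrite aE b0 in ex ex' ez ez' ew ew' *.
  by apply: Or33; do !split=> //; lra.
have [t1 t2] : x1 + y3 = 0 /\ x2 + y4 = 0 by apply: (complex_mul_eq0 cd0); lra.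
have [x10 x20] : x1 = 0 /\ x2 = 0 by apply: (complex_mul_eq0 ab0); lra.
have [x30 x40] : x3 = 0 /\ x4 = 0 by apply: (complex_mul_eq0 ab0); lra.
by apply: Or31; do !split=> //; lra.
Qed.

End Intertwiner.

(** * Structure constants and the Jacobi identity *)

Section Classification.
Set Implicit Arguments.
Unset Strict Implicit.
Variables (R : realType) (L : vectType R).
Variables (br : {bilinear L -> L -> L}) (g : {dot L for idfun}).
Variables (X Y Z A B : L).
Hypothesis brP : lie_bracket br.
Hypothesis gP : orthonormal g [:: X; Y; Z; A; B].
Hypothesis fullP : basis_of fullv [:: X; Y; Z; A; B].
Hypothesis g4P : g4_brackets br X Y Z.

Lemma bracketC u v : br u v = - br v u.
Proof.
have /eqP := brP.1 (u + v); rewrite linearDl !linearDr /= !brP.1 addr0 add0r.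
by rewrite addr_eq0 => /eqP.
Qed.

Lemma bracketDl u v w : br (u + v) w = br u w + br v w.
Proof. exact: linearDl. Qed.
Lemma bracketDr u v w : br u (v + w) = br u v + br u w.
Proof. exact: linearDr. Qed.
Lemma bracketZl k u v : br (k *: u) v = k *: br u v.
Proof. exact: linearZl_LR. Qed.
Lemma bracketZr k u v : br u (k *: v) = k *: br u v.
Proof. exact: linearZr_LR. Qed.
Lemma bracketNr u v : br u (- v) = - br u v.
Proof. exact: linearNr. Qed.
Lemma bracket0r u : br u 0 = 0.
Proof. exact: linear0r. Qed.
Definition bracketE :=
  (bracketDl, bracketDr, bracketZl, bracketZr, bracketNr, bracket0r, brP.1).

Lemma dotDl u v w : g (u + v) w = g u w + g v w.
Proof. exact: linearDl. Qed.
Lemma dotZl k u v : g (k *: u) v = k * g u v.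
Proof. exact: linearZl_LR. Qed.
Lemma dotNl u v : g (- u) v = - g u v.
Proof. exact: linearNl. Qed.
Lemma dot0l u : g 0 u = 0.
Proof. exact: linear0l. Qed.
Definition dotE := (dotDl, dotZl, dotNl, dot0l).

Lemma jacobi_coord u v w e :
  g (br u (br v w)) e + g (br v (br w u)) e + g (br w (br u v)) e = 0.
Proof. by rewrite -!dotDl brP.2 dot0l. Qed.

Lemma orthonormal5 :
  ((g X X = 1) * (g Y Y = 1) * (g Z Z = 1) * (g A A = 1) * (g B B = 1)) *
  ((g X Y = 0) * (g X Z = 0) * (g X A = 0) * (g X B = 0) * (g Y Z = 0) *
   (g Y A = 0) * (g Y B = 0) * (g Z A = 0) * (g Z B = 0) * (g A B = 0)) *
  ((g Y X = 0) * (g Z X = 0) * (g A X = 0) * (g B X = 0) * (g Z Y = 0) *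
   (g A Y = 0) * (g B Y = 0) * (g A Z = 0) * (g B Z = 0) * (g B A = 0)).
Proof.
move: gP; rewrite /orthonormal /= !andbT.
case/andP=> /and5P[/eqP-> /eqP-> /eqP-> /eqP-> /eqP->].
case/and4P=> /and4P[/eqP h1 /eqP h2 /eqP h3 /eqP h4].
case/and3P=> /eqP h5 /eqP h6 /eqP h7 /andP[/eqP h8 /eqP h9] /eqP h10.
by rewrite ![g Y X]dotC ![g Z _]dotC ![g A _]dotC ![g B _]dotC;
   do !split; rewrite ?h1 ?h2 ?h3 ?h4 ?h5 ?h6 ?h7 ?h8 ?h9 ?h10.
Qed.

Lemma coord5 w :
  w = g w X *: X + g w Y *: Y + g w Z *: Z + g w A *: A + g w B *: B.
Proof.
have w_span : w \in <<[:: X; Y; Z; A; B]>>%VS.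
  by rewrite (span_basis fullP) memvf.
by rewrite {1}(orthonormal_coord gP w_span) !(big_cons, big_nil) addr0 !addrA.
Qed.

Lemma coord_ext u v :
  g u X = g v X -> g u Y = g v Y -> g u Z = g v Z -> g u A = g v A ->
  g u B = g v B -> u = v.
Proof.
by move=> eX eY eZ eA eB; rewrite [u]coord5 [v]coord5 eX eY eZ eA eB.
Qed.

(** Only these ten orders are rewritten, so that rewriting with skew-symmetry
    terminates. *)
Definition reversedE :=
  (bracketC X Z, bracketC Y Z, bracketC Y X, bracketC A X, bracketC A Y,
   bracketC A Z, bracketC B X, bracketC B Y, bracketC B Z, bracketC B A).

(** With the brackets of basis vectors added, this turns a component of a
    Jacobi identity into a polynomial equation in the structure constants. *)
Definition coordE := (reversedE, bracketE, dotE, orthonormal5).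

(** Modulo V the action on H is by complex scalars a_k + i b_k, which vanish on
    the commutators X = [Z, X] and X + Y = [Z, Y].  Then Jacobi on (X, Y, E)
    reads [X, [Y, E]] = [Y, [X, E]], where only the Z-components of [Y, E] and
    [X, E] contribute; they vanish because [X, Z] = - X and [Y, Z] = - X - Y
    are independent. *)
Lemma derived_algebra_acts_vertically x1 y1 z1 x2 y2 z2 x3 y3 z3 x4 y4 z4
  x5 y5 z5 x6 y6 z6 a1 b1 a2 b2 a b :
  br X A = x1 *: X + y1 *: Y + z1 *: Z + a1 *: A + b1 *: B ->
  br X B = x2 *: X + y2 *: Y + z2 *: Z + (- b1) *: A + a1 *: B ->
  br Y A = x3 *: X + y3 *: Y + z3 *: Z + a2 *: A + b2 *: B ->
  br Y B = x4 *: X + y4 *: Y + z4 *: Z + (- b2) *: A + a2 *: B ->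
  br Z A = x5 *: X + y5 *: Y + z5 *: Z + a *: A + b *: B ->
  br Z B = x6 *: X + y6 *: Y + z6 *: Z + (- b) *: A + a *: B ->
  [/\ a1 = 0, b1 = 0, a2 = 0 & b2 = 0] /\
  [/\ z1 = 0, z2 = 0, z3 = 0 & z4 = 0].
Proof.
move=> XA XB YA YB ZA ZB; have [ZX ZY XY] := g4P.
pose tbl := (coordE, XA, XB, YA, YB, ZA, ZB, ZX, ZY, XY).
have e1 := jacobi_coord Z X A A; rewrite !tbl in e1.
have e2 := jacobi_coord Z X A B; rewrite !tbl in e2.
have e3 := jacobi_coord Z Y A A; rewrite !tbl in e3.
have e4 := jacobi_coord Z Y A B; rewrite !tbl in e4.
have a1E : a1 = 0 by clear -e1; lra.
have b1E : b1 = 0 by clear -e2; lra.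
have a2E : a2 = 0 by clear -e3 a1E; lra.
have b2E : b2 = 0 by clear -e4 b1E; lra.
have e5 := jacobi_coord X Y A X; rewrite !tbl in e5.
have e6 := jacobi_coord X Y A Y; rewrite !tbl in e6.
have e7 := jacobi_coord X Y B X; rewrite !tbl in e7.
have e8 := jacobi_coord X Y B Y; rewrite !tbl in e8.
rewrite a1E b1E a2E b2E in e5 e6 e7 e8 *.
by split; split=> //; clear -e5 e6 e7 e8; lra.
Qed.

(** The Z-components of [Z, A] and [Z, B] are the ones dictated by
    minimality. *)
Lemma vertical_action_cases x1 y1 x2 y2 x3 y3 x4 y4 x5 y5 x6 y6 a b :
  br X A = x1 *: X + y1 *: Y -> br X B = x2 *: X + y2 *: Y ->
  br Y A = x3 *: X + y3 *: Y -> br Y B = x4 *: X + y4 *: Y ->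
  br Z A = x5 *: X + y5 *: Y + (- (x1 + y3)) *: Z + a *: A + b *: B ->
  br Z B = x6 *: X + y6 *: Y + (- (x2 + y4)) *: Z + (- b) *: A + a *: B ->
  [/\ y1 = 0 & y2 = 0] /\
  [\/ [/\ x1 = 0, x2 = 0, x3 = 0, x4 = 0 & (y3 = 0 /\ y4 = 0)] /\
        (a != 0) || (b != 0),
      [/\ a = 0, b = 0, x1 = 0 & x2 = 0] /\ (y3 = 0 /\ y4 = 0)
    | [/\ a = -2, b = 0, y3 = x1 & y4 = x2] /\ (x3 = x1 /\ x4 = x2)].
Proof.
move=> XA XB YA YB ZA ZB; have [ZX ZY XY] := g4P.
pose tbl := (coordE, XA, XB, YA, YB, ZA, ZB, ZX, ZY, XY).
have e1 := jacobi_coord Z X A X; rewrite !tbl in e1.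
have e2 := jacobi_coord Z X B X; rewrite !tbl in e2.
have e3 := jacobi_coord Z X A Y; rewrite !tbl in e3.
have e4 := jacobi_coord Z X B Y; rewrite !tbl in e4.
have e5 := jacobi_coord Z Y A X; rewrite !tbl in e5.
have e6 := jacobi_coord Z Y B X; rewrite !tbl in e6.
have e7 := jacobi_coord Z Y A Y; rewrite !tbl in e7.
have e8 := jacobi_coord Z Y B Y; rewrite !tbl in e8.
by apply: intertwiner_cases; clear -e1 e2 e3 e4 e5 e6 e7 e8; lra.
Qed.

(** Here A and B commute with <X, Y>, and Jacobi on (Z, A, B) says that
    [A, B] is an eigenvector of ad Z for 2 a, the trace of the action on H.
    Its A-part vanishes because c is nonzero, its Z-part because it commutes
    with X. On <X, Y> the only eigenvalue of ad Z is 1, with eigenline <X>; this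
    singles out a = 1/2. *)
Lemma rotation_families (x5 y5 x6 y6 a b r t1 t2 t3 : R) :
  (a != 0) || (b != 0) ->
  br X A = 0 -> br X B = 0 -> br Y A = 0 -> br Y B = 0 ->
  br Z A = x5 *: X + y5 *: Y + a *: A + b *: B ->
  br Z B = x6 *: X + y6 *: Y + (- b) *: A + a *: B ->
  br A B = t1 *: X + t2 *: Y + t3 *: Z + r *: A ->
  family1 br X Y Z A B \/ family2 br X Y Z A B.
Proof.
move=> ab0 XA XB YA YB ZA ZB AB; have [ZX ZY XY] := g4P.
pose tbl := (coordE, XA, XB, YA, YB, ZA, ZB, AB, ZX, ZY, XY).
have e1 := jacobi_coord X A B X; rewrite !tbl in e1.
have e2 := jacobi_coord Z A B A; rewrite !tbl in e2.
have e3 := jacobi_coord Z A B B; rewrite !tbl in e3.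
have e4 := jacobi_coord Z A B X; rewrite !tbl in e4.
have e5 := jacobi_coord Z A B Y; rewrite !tbl in e5.
have t30 : t3 = 0 by clear tbl; lra.
have r0 : r = 0.
  case/orP: ab0 => [a0 | b0]; [apply: (mulfI a0) | apply: (mulfI b0)];
    clear tbl; lra.
have [a2 | a2] := eqVneq (2 * a - 1) 0.
  have aE : a = 1 / 2 by clear tbl; lra.
  subst a r t3; right; exists b, x5, y5, x6, y6, t1.
  do !split=> //; apply: coord_ext; rewrite !tbl; clear tbl e1 e2; lra.
subst r t3; left; exists a, b, x5, y5, x6, y6.
have t20 : t2 = 0 by apply: (mulfI a2); clear tbl; lra.
have t10 : t1 = 0 by apply: (mulfI a2); clear tbl; subst t2; lra.
do !split=> //; apply: coord_ext; rewrite !tbl; clear tbl e1 e2; lra.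
Qed.

(** The (X, A, B) and (Y, A, B) identities give r x3 n = t3 (1 + n), hence
    t3 = 0 and r x3 = 0: this product is what separates the two families. *)
Lemma nilpotent_families x3 x4 x5 y5 x6 y6 r t1 t2 t3 :
  br X A = 0 -> br X B = 0 -> br Y A = x3 *: X -> br Y B = x4 *: X ->
  br Z A = x5 *: X + y5 *: Y -> br Z B = x6 *: X + y6 *: Y ->
  br A B = t1 *: X + t2 *: Y + t3 *: Z + r *: A ->
  family3 br X Y Z A B \/ family4 br X Y Z A B.
Proof.
move=> XA XB YA YB ZA ZB AB; have [ZX ZY XY] := g4P.
pose tbl := (coordE, XA, XB, YA, YB, ZA, ZB, AB, ZX, ZY, XY).
have e1 := jacobi_coord X A B X; rewrite !tbl in e1.
have e2 := jacobi_coord Y A B X; rewrite !tbl in e2.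
have e4 := jacobi_coord Z A B X; rewrite !tbl in e4.
have e5 := jacobi_coord Z A B Y; rewrite !tbl in e5.
have t30 : t3 = 0 by clear tbl; lra.
have /eqP : r * x3 = 0 by clear tbl; lra.
rewrite mulf_eq0 => /orP[] /eqP E; [right | left].
  exists x3, x4, x5, y5, x6, y6; subst t3; rewrite E in e4 e5 *.
  do !split=> //; apply: coord_ext; rewrite !tbl; clear tbl e1 e2; lra.
exists x4, x5, y5, x6, y6, r; subst t3; rewrite E in e4 e5 *.
do !split=> //; apply: coord_ext; rewrite !tbl; clear tbl e1 e2; lra.
Qed.

(** The Z-components of [Z, A] and [Z, B] feed ad A and ad B back into Jacobi on
    (Z, A, B): its H-part forces p = 0 and r = - 2 q. *)
Lemma homothety_family p q x5 y5 x6 y6 r t1 t2 t3 :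
  br X A = p *: X -> br X B = q *: X ->
  br Y A = p *: X + p *: Y -> br Y B = q *: X + q *: Y ->
  br Z A = x5 *: X + y5 *: Y + (- (p + p)) *: Z + (-2) *: A ->
  br Z B = x6 *: X + y6 *: Y + (- (q + q)) *: Z + (-2) *: B ->
  br A B = t1 *: X + t2 *: Y + t3 *: Z + r *: A ->
  family5 br X Y Z A B.
Proof.
move=> XA XB YA YB ZA ZB AB; have [ZX ZY XY] := g4P.
pose tbl := (coordE, XA, XB, YA, YB, ZA, ZB, AB, ZX, ZY, XY).
have e1 := jacobi_coord X A B X; rewrite !tbl in e1.
have e2 := jacobi_coord Z A B A; rewrite !tbl in e2.
have e3 := jacobi_coord Z A B B; rewrite !tbl in e3.
have e4 := jacobi_coord Z A B X; rewrite !tbl in e4.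
have e5 := jacobi_coord Z A B Y; rewrite !tbl in e5.
have p0 : p = 0 by clear tbl; lra.
have rE : r = - (2 * q) by clear tbl; lra.
have t30 : t3 = 0 by clear tbl; subst p; lra.
exists q, x5, y5, x6, y6; subst r p t3.
do !split=> //; apply: coord_ext; rewrite !tbl; clear tbl e1 e2; lra.
Qed.

End Classification.

(** * The classification *)

Theorem theorem10p1 (R : realType) (L : vectType R)
    (br : {bilinear L -> L -> L}) (g : {dot L for idfun})
    (nabla : {bilinear L -> L -> L}) (V : {vspace L}) (X Y Z A B : L)
    (hdim : \dim {:L} = 5%N)
    (hbr : lie_bracket br)
    (hnabla : levi_civita br nabla g)
    (hint : integrable_dist br V)
    (hconf : conformal_dist nabla g V)
    (hmin : minimal_dist nabla g V)
    (hbasis : adapted_basis br g V X Y Z A B)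
    (hg4 : g4_brackets br X Y Z) :
  family1 br X Y Z A B \/ family2 br X Y Z A B \/ family3 br X Y Z A B \/
  family4 br X Y Z A B \/ family5 br X Y Z A B.
Proof.
have [basisT onT VE WE horAB] := hbasis.
have brC := bracketC hbr; have coord := coord5 onT basisT.
have dotT := orthonormal5 onT.
have VW : (V + orthov g V = fullv)%VS.
  by rewrite WE VE -span_cat (span_basis basisT).
have [XV YV ZV] : [/\ X \in V, Y \in V & Z \in V].
  by rewrite VE; split; apply: memv_span; rewrite !inE eqxx ?orbT.
have [AW BW] : A \in orthov g V /\ B \in orthov g V.
  by rewrite WE; split; apply: memv_span; rewrite !inE eqxx ?orbT.
have [v0 conf] := conformal_bracket brC hnabla VW hconf.
have rotB u : u \in V ->
    g (br u B) A = - g (br u A) B /\ g (br u B) B = g (br u A) A.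
  move=> uV; have := conf u A B uV AW BW; have := conf u A A uV AW AW.
  by have := conf u B B uV BW BW; rewrite !dotT => *; split; lra.
have trace0 e : e \in orthov g V ->
    g (br Z e) Z = - (g (br X e) X + g (br Y e) Y).
  move=> eW; have onV : orthonormal g [:: X; Y; Z].
    by rewrite /orthonormal /= !dotT !eqxx.
  have basisV : basis_of V [:: X; Y; Z].
    rewrite /basis_of VE eqxx /=.
    by apply: (@catl_free _ _ [:: A; B]); apply: (basis_free basisT).
  have := minimal_bracket brC hnabla VW hmin basisV onV eW.
  rewrite !(big_cons, big_nil) => ?; lra.
have ABB : g (br A B) B = 0.
  rewrite -(dot_hor_proj VW _ BW).
  by have /vlineP[k ->] := horAB; rewrite dotZl dotT mulr0.
(* These tables are self-referential: the coefficients of a bracket are inner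
   products with that same bracket.  The preceding lemmas avoid looping by
   taking the coefficients as variables. *)
have XA := coord (br X A); have YA := coord (br Y A); have ZA := coord (br Z A).
have XB := coord (br X B); have YB := coord (br Y B); have ZB := coord (br Z B).
have AB := coord (br A B); rewrite ABB scale0r addr0 in AB.
rewrite !(rotB _ XV).1 !(rotB _ XV).2 in XB.
rewrite !(rotB _ YV).1 !(rotB _ YV).2 in YB.
rewrite !(rotB _ ZV).1 !(rotB _ ZV).2 in ZB.
have [[a1 b1 a2 b2] [z1 z2 z3 z4]] :=
  derived_algebra_acts_vertically hbr onT hg4 XA XB YA YB ZA ZB.
rewrite trace0 // in ZA; rewrite trace0 // in ZB.
rewrite !(a1, b1, a2, b2, z1, z2, z3, z4, oppr0, scale0r, addr0) in XA XB YA YB.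
have [[y1 y2] cases] := vertical_action_cases hbr onT hg4 XA XB YA YB ZA ZB.
rewrite !(y1, y2, scale0r, addr0) in XA XB.
case: cases => [[[x1 x2 x3 x4 [y3 y4]] ab0] | [[a0 b0 x1 x2] [y3 y4]]
               | [[aE b0 y3 y4] [x3 x4]]].
- rewrite !(x1, x2, x3, x4, y3, y4, addr0, oppr0, scale0r) in XA XB YA YB ZA ZB.
  have := rotation_families hbr onT basisT hg4 ab0 XA XB YA YB ZA ZB AB.
  by case; auto.
- rewrite !(a0, b0, x1, x2, y3, y4, addr0, oppr0, scale0r) in XA XB YA YB ZA ZB.
  have := nilpotent_families hbr onT basisT hg4 XA XB YA YB ZA ZB AB.
  by case; auto.
- rewrite !(x3, x4, y3, y4) in YA YB ZA ZB.
  rewrite !(aE, b0, oppr0, scale0r, addr0) in ZA ZB.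
  by have := homothety_family hbr onT basisT hg4 XA XB YA YB ZA ZB AB; auto.
Qed.
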